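(* Let $T_n$ denote the total number of strict left to right maxima, summed over all Dyck paths of semi-length $n$, and let $\mathrm{Tot}=\sum_{n\ge 1}T_n z^{2n}$. Then, with $u$ the power series in $z$ defined by $u=\frac{1-2z^2-\sqrt{1-4z^2}}{2z^2}$ (so that $z^2=\frac{u}{(1+u)^2}$), \[ \mathrm{Tot}=\sum_{r=1}^\infty \frac{(1-u)u^r}{1-u^{1+r}}. \]
   Context: A Dyck path of semi-length $n$ is a lattice path from $(0,0)$ to $(2n,0)$ with $n$ up steps $(1,1)$ and $n$ down steps $(1,-1)$ never going below the $x$-axis. A peak is an up step immediately followed by a down step, and its height is the height of its top point. A strict left to right maximum is a peak whose height is strictly greater than the heights of all peaks to its left. *)

(* Defs.v *)
(* boolp only provides the eqType and choiceType structures on power series. *)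
From HB Require Import structures.
From mathcomp Require Import all_boot all_order all_algebra.
From mathcomp Require Import boolp.

Set Implicit Arguments.
Unset Strict Implicit.
Unset Printing Implicit Defensive.

Import Order.TTheory GRing.Theory Num.Theory.
Local Open Scope ring_scope.

(* The ring F[[z]] of formal power series over a field; a series is applied to
   n to get its coefficient of z^n. *)
Record fps (F : fieldType) := Fps { fps_coef :> nat -> F }.

Section FormalPowerSeries.
Variable F : fieldType.
Implicit Types a b c : fps F.

Lemma fpsP a b : (forall n, a n = b n) <-> a = b.
Proof.
split=> [eq_ab | -> //]; case: a b eq_ab => [f] [g] /= eq_fg.
by congr Fps; apply/funext.
Qed.

HB.instance Definition _ := gen_eqMixin (fps F).
HB.instance Definition _ := gen_choiceMixin (fps F).

Definition fps_zero : fps F := Fps (fun=> 0).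
Definition fps_opp a : fps F := Fps (fun n => - a n).
Definition fps_add a b : fps F := Fps (fun n => a n + b n).

Fact fps_addA : associative fps_add.
Proof. by move=> a b c; apply/fpsP => n /=; rewrite addrA. Qed.
Fact fps_addC : commutative fps_add.
Proof. by move=> a b; apply/fpsP => n /=; rewrite addrC. Qed.
Fact fps_add0 : left_id fps_zero fps_add.
Proof. by move=> a; apply/fpsP => n /=; rewrite add0r. Qed.
Fact fps_addN : left_inverse fps_zero fps_opp fps_add.
Proof. by move=> a; apply/fpsP => n /=; rewrite addNr. Qed.

HB.instance Definition _ :=
  GRing.isZmodule.Build (fps F) fps_addA fps_addC fps_add0 fps_addN.

Definition fps_one : fps F := Fps (fun n => (n == 0)%:R).
Definition fps_mul a b : fps F :=
  Fps (fun n => \sum_(i < n.+1) a i * b (n - i)%N).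

Let trunc n a : {poly F} := \poly_(i < n.+1) a i.

Let coef_trunc n a i : (i <= n)%N -> (trunc n a)`_i = a i.
Proof. by move=> le_in; rewrite coef_poly ltnS le_in. Qed.

Let coef_trunc_mul n a b i :
  (i <= n)%N -> (trunc n a * trunc n b)`_i = fps_mul a b i.
Proof.
move=> le_in; rewrite coefM /=; apply: eq_bigr => j _.
rewrite !coef_trunc //; first exact: leq_trans (leq_subr _ _) le_in.
by apply: leq_trans le_in; rewrite -ltnS.
Qed.

Fact fps_mulC : commutative fps_mul.
Proof.
by move=> a b; apply/fpsP => n; rewrite -!(@coef_trunc_mul n) // mulrC.
Qed.

Fact fps_mulA : associative fps_mul.
Proof.
move=> a b c; apply/fpsP => n.
transitivity ((trunc n a * (trunc n b * trunc n c))`_n).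
  rewrite coefM /=; apply: eq_bigr => j _.
  by rewrite coef_trunc; [rewrite coef_trunc_mul ?leq_subr | rewrite -ltnS].
rewrite mulrA coefM /=; apply: eq_bigr => j _.
by rewrite coef_trunc ?leq_subr // coef_trunc_mul // -ltnS.
Qed.

Fact fps_mul1 : left_id fps_one fps_mul.
Proof.
move=> a; apply/fpsP => n /=; rewrite big_ord_recl /= mul1r subn0 big1 ?addr0 //.
by move=> i _; rewrite mul0r.
Qed.

Fact fps_mulDl : left_distributive fps_mul fps_add.
Proof.
move=> a b c; apply/fpsP => n /=; rewrite -big_split /=.
by apply: eq_bigr => i _; rewrite mulrDl.
Qed.

Fact fps_one_neq0 : fps_one != fps_zero.
Proof. by apply/eqP => /fpsP /(_ 0) /eqP; rewrite oner_eq0. Qed.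

HB.instance Definition _ := GRing.Zmodule_isComNzRing.Build (fps F)
  fps_mulA fps_mulC fps_mul1 fps_mulDl fps_one_neq0.

Lemma fps_coef0 n : (0 : fps F) n = 0. Proof. by []. Qed.
Lemma fps_coef1 n : (1 : fps F) n = (n == 0)%:R. Proof. by []. Qed.
Lemma fps_coefD a b n : (a + b) n = a n + b n. Proof. by []. Qed.
Lemma fps_coefN a n : (- a) n = - a n. Proof. by []. Qed.
Lemma fps_coefB a b n : (a - b) n = a n - b n. Proof. by []. Qed.
Lemma fps_coefM a b n : (a * b) n = \sum_(i < n.+1) a i * b (n - i)%N.
Proof. by []. Qed.

Lemma fps_coefMn a m n : (a *+ m) n = a n *+ m.
Proof. by elim: m => [|m IHm]; rewrite ?mulr0n // !mulrS fps_coefD IHm. Qed.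

Lemma fps_coef_sum I (r : seq I) (P : pred I) (f : I -> fps F) n :
  (\sum_(i <- r | P i) f i) n = \sum_(i <- r | P i) f i n.
Proof. by apply: (big_morph (fun a : fps F => a n)). Qed.

Lemma fps_coefM0 a b : (a * b) 0 = a 0 * b 0.
Proof. by rewrite fps_coefM big_ord_recl big_ord0 addr0. Qed.

Lemma fps_coefX_lt a k n : a 0 = 0 -> (n < k)%N -> (a ^+ k) n = 0.
Proof.
move=> a0; elim: k n => // k IHk n lt_nk; rewrite exprS fps_coefM.
rewrite big_ord_recl a0 mul0r add0r big1 // => i _.
rewrite IHk ?mulr0 //=; case: n lt_nk i => [|n] lt_nk i; first by case: i.
by rewrite subSS; move: lt_nk; rewrite ltnS; apply: leq_ltn_trans (leq_subr _ _).
Qed.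

(* Geometric series: if a = a_0 (1 - v) with a_0 != 0, then v has no constant
   term and 1/a = a_0^-1 (1 + v + v^2 + ...); only the powers v^0, ..., v^n
   contribute to the coefficient of z^n. *)
Definition fps_unit : {pred fps F} := fun a => a 0 != 0.
Definition fps_const (x : F) : fps F := Fps (fun n => if n == 0 then x else 0).
Definition fps_inv a : fps F :=
  if a 0 == 0 then a else
  Fps (fun n => (a 0)^-1 *
    (\sum_(k < n.+1) (1 - fps_const (a 0)^-1 * a) ^+ k) n).

Let coef_constM x a n : (fps_const x * a) n = x * a n.
Proof.
rewrite fps_coefM big_ord_recl /= subn0 big1 ?addr0 // => i _.
by rewrite mul0r.
Qed.

Fact fps_mulVx : {in fps_unit, left_inverse 1 fps_inv *%R}.
Proof.
move=> a; rewrite unfold_in => a0; rewrite /fps_inv (negPf a0).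
set v := 1 - _.
have v0 : v 0 = 0.
  by rewrite /v fps_coefB coef_constM mulVf // subrr.
have av : fps_const (a 0)^-1 * a = 1 - v by rewrite /v opprB addrC subrK.
apply/fpsP => n.
transitivity (((\sum_(k < n.+1) v ^+ k) * (1 - v)) n).
  rewrite -av mulrA (mulrC _ (fps_const _)) !fps_coefM.
  apply: eq_bigr => i _; congr (_ * _); rewrite coef_constM /=; congr (_ * _).
  rewrite !fps_coef_sum.
  have le_in : (i.+1 <= n.+1)%N by [].
  rewrite (big_ord_widen _ (fun k => (v ^+ k) i) le_in) big_mkcond /=.
  apply: eq_bigr => k _; case: ifPn => //; rewrite -leqNgt => lt_ik.
  by rewrite fps_coefX_lt.
rewrite mulrC -opprB mulNr -subrX1 opprB fps_coefB fps_coefX_lt //.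
by rewrite subr0.
Qed.

Fact fps_unitPl a b : b * a = 1 -> fps_unit a.
Proof.
move=> /fpsP /(_ 0); rewrite fps_coefM0 fps_coef1 => ba.
by apply/eqP => a0; move/eqP: ba; rewrite a0 mulr0 eq_sym oner_eq0.
Qed.

Fact fps_inv_out : {in [predC fps_unit], fps_inv =1 id}.
Proof. by move=> a; rewrite inE negbK /fps_inv => ->. Qed.

HB.instance Definition _ := GRing.ComNzRing_hasMulInverse.Build (fps F)
  fps_mulVx fps_unitPl fps_inv_out.

Lemma fps_unitE a : (a \is a GRing.unit) = (a 0 != 0).
Proof. by []. Qed.

Definition fpsX : fps F := Fps (fun n => (n == 1)%:R).

Lemma fps_coefXM a n : (fpsX * a) n = if n is m.+1 then a m else 0.
Proof.
case: n => [|n]; first by rewrite fps_coefM0 mul0r.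
rewrite fps_coefM 2!big_ord_recl /= mul0r add0r mul1r subSS subn0 big1 ?addr0//.
by move=> i _; rewrite mul0r.
Qed.

Lemma fps_coefXnM a k n :
  (fpsX ^+ k * a) n = if (n < k)%N then 0 else a (n - k)%N.
Proof.
elim: k n => [|k IHk] n; first by rewrite expr0 mul1r ltn0 subn0.
by rewrite exprS -mulrA fps_coefXM; case: n => // n; rewrite IHk ltnS subSS.
Qed.

(* Quotient by z^k of a series whose coefficients of z^0, ..., z^(k-1) vanish
   (these coefficients are dropped). *)
Definition fps_divXn k a : fps F := Fps (fun n => a (n + k)%N).

Lemma fps_divXnK k a :
  (forall i, (i < k)%N -> a i = 0) -> fpsX ^+ k * fps_divXn k a = a.
Proof.
move=> a_lt; apply/fpsP => n; rewrite fps_coefXnM.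
by case: ltnP => [/a_lt -> // | le_kn]; rewrite /= subnK.
Qed.

(* The square root, with constant term 1, of a series with constant term 1 (in
   characteristic different from 2): solving s^2 = a for the coefficient of z^n
   gives s_n = (a_n - (s_1 s_(n-1) + ... + s_(n-1) s_1)) / 2. *)
Fixpoint fps_sqrt_seq a n : seq F :=
  if n is m.+1 then
    let s := fps_sqrt_seq a m in
    rcons s ((a n - \sum_(1 <= i < n) s`_i * s`_(n - i)) / 2%:R)
  else [:: 1].

Definition fps_sqrt a : fps F := Fps (fun n => (fps_sqrt_seq a n)`_n).

Let size_sqrt_seq a n : size (fps_sqrt_seq a n) = n.+1.
Proof. by elim: n => //= n IHn; rewrite size_rcons IHn. Qed.

Let nth_sqrt_seq a n i :
  (i <= n)%N -> (fps_sqrt_seq a n)`_i = fps_sqrt a i.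
Proof.
elim: n => [|n IHn]; first by rewrite leqn0 => /eqP ->.
rewrite leq_eqVlt => /predU1P[-> // | lt_in].
by rewrite /= nth_rcons size_sqrt_seq lt_in IHn.
Qed.

Lemma fps_sqrt0 a : fps_sqrt a 0 = 1. Proof. by []. Qed.

Lemma fps_sqrtS a n :
  fps_sqrt a n.+1 =
  (a n.+1 - \sum_(1 <= i < n.+1) fps_sqrt a i * fps_sqrt a (n.+1 - i)%N)
    / 2%:R.
Proof.
rewrite [LHS]/= nth_rcons size_sqrt_seq ltnn eqxx; congr ((_ - _) / _).
rewrite big_nat_cond [RHS]big_nat_cond; apply: eq_bigr => i.
rewrite andbT => /andP[i_gt0 lt_in].
by rewrite !nth_sqrt_seq // leq_subLR -add1n leq_add2r.
Qed.

Lemma fps_sqrK a : 2%:R != 0 :> F -> a 0 = 1 -> fps_sqrt a ^+ 2 = a.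
Proof.
move=> nz2 a0; apply/fpsP => -[|n].
  by rewrite expr2 fps_coefM0 fps_sqrt0 mul1r a0.
have := fps_sqrtS a n; have := fps_sqrt0 a; move: (fps_sqrt a) => s s0 sS.
rewrite expr2 fps_coefM -(big_mkord xpredT (fun i => s i * s (n.+1 - i)%N)).
rewrite big_nat_recr //= big_ltn // subnn subn0 s0 mul1r mulr1.
by rewrite addrAC -mulr2n -mulr_natr sS divfK // subrK.
Qed.

(* S is the sum of the series of power series f m + f (m+1) + ..., that is the
   limit of its partial sums in the z-adic topology: the coefficient of each
   z^k is eventually constant. *)
Definition fps_has_sum (m : nat) (f : nat -> fps F) (S : fps F) : Prop :=
  forall k, exists N, forall n, (N <= n)%N ->
    (\sum_(m <= r < n) f r) k = S k.

Lemma fps_has_sum_unique m f S1 S2 :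
  fps_has_sum m f S1 -> fps_has_sum m f S2 -> S1 = S2.
Proof.
move=> sum1 sum2; apply/fpsP => k.
have [[N1 S1E] [N2 S2E]] := (sum1 k, sum2 k).
by rewrite -(S1E (maxn N1 N2)) ?leq_maxl // S2E ?leq_maxr.
Qed.

End FormalPowerSeries.

(* A lattice path from (0,0) with steps (1,1) and (1,-1) is a sequence of
   booleans: true is an up step, false a down step. *)
Definition step (b : bool) : int := if b then 1 else -1.

(* Ordinate of the path at abscissa k, for k <= size w. *)
Definition height (w : seq bool) (k : nat) : int :=
  \sum_(b <- take k w) step b.

Definition dyck (n : nat) (w : seq bool) : bool :=
  [&& count_mem true w == n, count_mem false w == n
    & [forall k : 'I_(size w).+1, 0 <= height w k]].

(* Peaks are indexed by their up step: steps i and i+1 form a peak, the top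
   point of which has abscissa i+1. *)
Definition peak (w : seq bool) (i : nat) : bool :=
  [&& (i.+1 < size w)%N, nth false w i & ~~ nth false w i.+1].

Definition peak_height (w : seq bool) (i : nat) : int := height w i.+1.

Definition strict_lr_max (w : seq bool) (i : nat) : bool :=
  peak w i &&
  [forall j : 'I_i, peak w j ==> (peak_height w j < peak_height w i)].

Definition T (n : nat) : nat :=
  \sum_(w : (n.*2).-tuple bool | dyck n w)
    #|[set i : 'I_(n.*2) | strict_lr_max w i]|.

Definition z : fps rat := fpsX rat.

Definition Tot : fps rat :=
  Fps (fun k => if (0 < k)%N && ~~ odd k then (T k./2)%:R else 0).

Lemma Tot_sum : fps_has_sum 1 (fun n => (T n)%:R * z ^+ n.*2) Tot.
Proof.
have coefTz n k : ((T n)%:R * z ^+ n.*2) k = if k == n.*2 then (T n)%:R else 0.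
  rewrite mulrC fps_coefXnM fps_coefMn fps_coef1 subn_eq0.
  by case: (ltngtP k n.*2) => _ //; rewrite mul0rn.
move=> k; exists k.+1 => n lt_kn; rewrite fps_coef_sum [RHS]/=.
under eq_bigr do rewrite coefTz.
rewrite -big_mkcond /=; case: ifPn => [/andP[k0 k_even] | k_out].
  have [h kE] : exists h, k = h.*2 by exists k./2; rewrite even_halfK.
  move: k0 lt_kn; rewrite kE doubleK double_gt0 => h0 lt_hn.
  rewrite (eq_bigl (pred1 h)); last first.
    by move=> i; rewrite /= (inj_eq double_inj) eq_sym.
  rewrite big_nat1_eq h0 (leq_ltn_trans _ lt_hn) //.
  by rewrite -addnn leq_addr.
rewrite big_nat_cond big1 // => i /andP[/andP[i0 _] /eqP kE].
by move: k_out; rewrite kE double_gt0 i0 odd_double.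
Qed.

Definition u : fps rat :=
  fps_divXn 2 (1 - 2%:R * z ^+ 2 - fps_sqrt (1 - 4%:R * z ^+ 2)) / 2%:R.

Lemma uE :
  2%:R * z ^+ 2 * u = 1 - 2%:R * z ^+ 2 - fps_sqrt (1 - 4%:R * z ^+ 2).
Proof.
have z2E n (a : fps rat) : (n < 2)%N -> (a * z ^+ 2) n = 0.
  by move=> lt_n2; rewrite mulrC fps_coefXnM lt_n2.
have two_unit : (2%:R : fps rat) \is a GRing.unit.
  by rewrite fps_unitE fps_coefMn.
rewrite /u -mulrA mulrC -mulrA divrK // fps_divXnK // => -[|[|//]] _.
  by rewrite !fps_coefB fps_sqrt0 z2E // subr0 subrr.
by rewrite !fps_coefB fps_sqrtS big_geq // !fps_coefB !z2E // !subr0 mul0r.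
Qed.

(* Main.v *)
(* A strict left to right maximum of height r is the first visit of the path to
   ordinate r, provided that visit is a peak; so a Dyck path has at most one of
   each height, and the r-th term of the series is the generating function of
   the Dyck paths which have one of height r.  Let s = z (1 + u), so that
   s^2 = u.  Paths going from ordinate h down to 0 have generating function
   z^h (1 + u)^(h+1), and those whose first visit to r > h is moreover a peak
   have s^(2r-h) (1 - u^(h+1)) / (1 - u^(r+1)): both families of series satisfy
   the recurrence given by the first step of the path, which determines their
   coefficients. *)
Require Import Defs.
From mathcomp Require Import all_boot all_order all_algebra.
From mathcomp Require Import ring zify.
Import Order.TTheory GRing.Theory Num.Theory.
Local Open Scope ring_scope.

(** * The quadratic equation of [u] and invertible series *)

Lemma fpsX2_inj (a b : fps rat) : z ^+ 2 * a = z ^+ 2 * b -> a = b.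
Proof.
move=> eq_ab; apply/fpsP => n; move/fpsP/(_ n.+2): eq_ab.
by rewrite !fps_coefXnM /= !subSS subn0.
Qed.

Lemma fps_nat_unit n : (n.+1%:R : fps rat) \is a GRing.unit.
Proof. by rewrite fps_unitE fps_coefMn pnatr_eq0. Qed.

(** The square root is [1 - 2 z^2 (1 + u)]; squaring it gives [1 - 4 z^2], and cancelling [4 z^2]
    leaves the quadratic equation. *)
Lemma u_fixpoint : u = z ^+ 2 * (1 + u) ^+ 2.
Proof.
have sqr_d : fps_sqrt (1 - 4%:R * z ^+ 2) ^+ 2 = 1 - 4%:R * z ^+ 2.
  by apply: fps_sqrK => //; rewrite fps_coefB mulrC fps_coefXnM subr0.
have d_u : fps_sqrt (1 - 4%:R * z ^+ 2) = 1 - 2%:R * z ^+ 2 * (1 + u).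
  by rewrite mulrDr mulr1 uE; ring.
apply: fpsX2_inj; apply: (mulrI (fps_nat_unit 3)).
move: sqr_d; rewrite d_u => sqr_d.
apply: (addrI (1 - 4%:R * z ^+ 2 * (1 + u))).
transitivity (1 - 4%:R * z ^+ 2); first by ring.
by rewrite -sqr_d; ring.
Qed.

Lemma u_coef0 : u 0 = 0.
Proof. by rewrite u_fixpoint fps_coefXnM. Qed.

Lemma one_plus_u_unit : 1 + u \is a GRing.unit.
Proof. by rewrite fps_unitE fps_coefD u_coef0 addr0 oner_eq0. Qed.

Lemma one_minus_uX_unit r : 1 - u ^+ r.+1 \is a GRing.unit.
Proof.
by rewrite fps_unitE fps_coefB fps_coefX_lt ?u_coef0 // subr0 oner_eq0.
Qed.

(** * Words counted by their first letter *)

Definition count_words m (P : seq bool -> bool) : nat :=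
  (\sum_(w : m.-tuple bool) P w)%N.

Lemma count_words0 P : count_words 0 P = P [::].
Proof.
rewrite /count_words (eq_bigr (fun=> P [::] : nat)) => [|w _].
  by rewrite sum_nat_const card_tuple expn0 mul1n.
by rewrite tuple0.
Qed.

Lemma count_wordsS m P :
  count_words m.+1 P =
  (count_words m (fun w => P (true :: w)) +
   count_words m (fun w => P (false :: w)))%N.
Proof.
rewrite /count_words.
rewrite (reindex (fun p : bool * m.-tuple bool => [tuple of p.1 :: p.2])) /=.
  rewrite -(pair_bigA _ (fun b (w : m.-tuple bool) => P (b :: w) : nat)) /=.
  by rewrite big_bool.
exists (fun w => (thead w, [tuple of behead w])) => [[b w] _ | w _] /=.
  by congr (_, _); apply: val_inj.
by rewrite [RHS]tuple_eta.
Qed.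

Lemma eq_count_words m P Q : P =1 Q -> count_words m P = count_words m Q.
Proof. by move=> eqPQ; apply: eq_bigr => w _; rewrite eqPQ. Qed.

Lemma count_words_pred0 m : count_words m (fun=> false) = 0.
Proof. by rewrite /count_words big1. Qed.

(** * Generating functions from the first step *)

(** The starting ordinate is a parameter, so that the first-step recurrence holds by computation. *)
Fixpoint descends (h : nat) (w : seq bool) : bool :=
  match w with
  | [::] => h == 0
  | true :: w' => descends h.+1 w'
  | false :: w' => (0 < h)%N && descends h.-1 w'
  end.

(* [first_visit_peak r h w], for [h < r]: the first visit of the path [w] from
   ordinate [h] to ordinate [r] exists and is the top of a peak. *)
Fixpoint first_visit_peak (r h : nat) (w : seq bool) : bool :=
  match w with
  | [::] => false
  | true :: w' =>
      if h.+1 == r then ~~ head true w' else first_visit_peak r h.+1 w'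
  | false :: w' => first_visit_peak r h.-1 w'
  end.

Lemma descends_gf h m :
  (count_words m (descends h))%:R = (z ^+ h * (1 + u) ^+ h.+1) m.
Proof.
elim: m h => [|m IHm] h.
  rewrite count_words0 fps_coefM0; case: h => [|h].
    by rewrite expr0 expr1 fps_coefD u_coef0 fps_coef1 mul1r addr0.
  by rewrite fps_coefX_lt // mul0r.
rewrite count_wordsS natrD IHm.
(* The last summand is [z] times the series for [h.-1] when [h > 0]. For [h = 0] it is 1, the empty
   path, invisible in positive degree. *)
have -> : z ^+ h * (1 + u) ^+ h.+1 =
    z * (z ^+ h.+1 * (1 + u) ^+ h.+2) + z ^+ h * (1 + u) ^+ h.
  have -> : z * (z ^+ h.+1 * (1 + u) ^+ h.+2) =
    z ^+ h * (1 + u) ^+ h * (z ^+ 2 * (1 + u) ^+ 2) by rewrite !exprS; ring.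
  by rewrite -u_fixpoint exprS; ring.
rewrite fps_coefD fps_coefXM; congr (_ + _).
case: h => [|h].
  by rewrite (@eq_count_words _ _ (fun=> false)) // count_words_pred0 mulr1.
by rewrite (@eq_count_words _ _ (descends h)) // IHm (exprS z) -mulrA fps_coefXM.
Qed.

(** First-step recurrence for the numerators, with [j.+1] in the role of [2r - h]. As the square of
    [z (1 + u)] is [u], it reduces to [(1 + u)(1 - u^(h+1)) = (1 - u^(h+2)) + u (1 - u^h)]. *)
Lemma strip_gf_step j h :
  (z * (1 + u)) ^+ j.+1 * (1 - u ^+ h.+1) =
  z * ((z * (1 + u)) ^+ j * (1 - u ^+ h.+2) +
       (z * (1 + u)) ^+ j.+2 * (1 - u ^+ h)).
Proof.
have s2 : (z * (1 + u)) * (z * (1 + u)) = u by rewrite [RHS]u_fixpoint; ring.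
rewrite (exprS _ j.+1) [(z * (1 + u)) ^+ j.+1]exprS.
rewrite [z * (1 + u) * (_ * _)]mulrA s2 !exprS; ring.
Qed.

(** Induction on the length by [strip_gf_step]. The denominator makes the formula equal to [s ^+ r]
    at [h = r], the series for a down step followed by a descent from [r.-1]. *)
Lemma first_visit_peak_gf r h m : (h < r)%N ->
  (count_words m (fun w => descends h w && first_visit_peak r h w))%:R =
  ((z * (1 + u)) ^+ (r + (r - h)) * (1 - u ^+ h.+1) / (1 - u ^+ r.+1)) m.
Proof.
set s := z * (1 + u); set D := 1 - u ^+ r.+1.
have D_unit : D \is a GRing.unit by apply: one_minus_uX_unit.
elim: m h => [|m IHm] h lt_hr.
  rewrite count_words0 [in LHS]/= andbF -mulrA fps_coefM0 fps_coefX_lt ?mul0r //.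
    by rewrite /s fps_coefM0 mul0r.
  by lia.
(* At ordinate 0 the down step is forbidden, in agreement with [1 - u ^+ 0 = 0]. *)
have down_step : (count_words m (fun w => descends h (false :: w) &&
    first_visit_peak r h (false :: w)))%:R =
    (s ^+ (r + (r - h)).+1 * (1 - u ^+ h) / D) m.
  case: h lt_hr => [|h] lt_hr.
    by rewrite count_words_pred0 expr0 subrr mulr0 mul0r.
  rewrite (@eq_count_words _ _
    (fun w => descends h w && first_visit_peak r h w)) //.
  by rewrite IHm ?(ltnW lt_hr) // -addnS subnSK ?(ltnW lt_hr).
rewrite count_wordsS natrD down_step.
have [eq_hr | neq_hr] := eqVneq h.+1 r.
  rewrite (@eq_count_words _ _ (fun w => descends h.+1 w && ~~ head true w));
    last by move=> w /=; rewrite eq_hr eqxx.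
  have -> : (r + (r - h) = r.+1)%N by lia.
  rewrite strip_gf_step -/s eq_hr -[in RHS]mulrA [in RHS]mulrDl fps_coefXM.
  rewrite fps_coefD; congr (_ + _).
  rewrite mulrK // -eq_hr.
  (* The default [true] of [head] rejects the empty word: the top of a peak must be followed by a
     down step. *)
  case: m {IHm down_step} => [|m].
    by rewrite count_words0 /= fps_coefX_lt // /s fps_coefM0 mul0r.
  rewrite count_wordsS (@eq_count_words _ _ (fun=> false)); last first.
    by move=> w; rewrite andbF.
  rewrite count_words_pred0 add0n (@eq_count_words _ _ (descends h)); last first.
    by move=> w; rewrite /= andbT.
  by rewrite descends_gf /s exprMn (exprS z) -mulrA fps_coefXM.
rewrite (@eq_count_words _ _
    (fun w => descends h.+1 w && first_visit_peak r h.+1 w)); last first.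
  by move=> w /=; rewrite (negPf neq_hr).
have -> : (r + (r - h) = (r + (r - h.+1)).+1)%N by lia.
rewrite strip_gf_step -/s -[in RHS]mulrA [in RHS]mulrDl fps_coefXM.
rewrite fps_coefD; congr (_ + _).
by rewrite IHm //; lia.
Qed.

(** * Heights, and Dyck paths as descents from 0 *)

Lemma height0 w : height w 0 = 0.
Proof. by rewrite /height take0 big_nil. Qed.

Lemma height_cons b w k : height (b :: w) k.+1 = step b + height w k.
Proof. by rewrite /height /= big_cons. Qed.

Lemma heightS w k : (k < size w)%N ->
  height w k.+1 = height w k + step (nth false w k).
Proof.
by move=> lt_kw; rewrite /height (take_nth false) // -cats1 big_cat big_seq1.
Qed.

Lemma height_le w k : height w k <= k%:Z.
Proof.
elim: w k => [|b w IHw] [|k]; rewrite ?height0 //.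
  by rewrite /height /= big_nil.
by rewrite height_cons; have := IHw k; case: b => /=; lia.
Qed.

Lemma height_size w :
  height w (size w) = (count_mem true w)%:Z - (count_mem false w)%:Z.
Proof.
elim: w => [|b w IHw]; first by rewrite height0.
by rewrite [size _]/= height_cons IHw; case: b => /=; lia.
Qed.

Lemma descendsP h w :
  reflect (h%:Z + height w (size w) = 0 /\
           forall k, (k <= size w)%N -> 0 <= h%:Z + height w k)
          (descends h w).
Proof.
apply: (iffP idP).
  elim: w h => [|b w IHw] h /=.
    by move/eqP->; split=> [|[]] //; rewrite height0.
  have step_case h' : h'%:Z = h%:Z + step b -> descends h' w ->
      h%:Z + height (b :: w) (size w).+1 = 0 /\
      forall k, (k <= (size w).+1)%N -> 0 <= h%:Z + height (b :: w) k.
    move=> h'E /IHw[end0 ge0]; split.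
      by rewrite height_cons; lia.
    case=> [|k] le_kw; first by rewrite height0; lia.
    by have := ge0 k le_kw; rewrite height_cons; lia.
  case: b step_case => step_case; first by apply: step_case => /=; lia.
  by case/andP=> h_gt0; apply: step_case => /=; lia.
elim: w h => [|b w IHw] h [end0 ge0] /=.
  by move: end0; rewrite height0 => ?; lia.
have step_case h' : h'%:Z = h%:Z + step b -> descends h' w.
  move=> h'E; apply: IHw; split.
    by move: end0; rewrite [size _]/= height_cons; lia.
  by move=> k le_kw; have := ge0 k.+1 le_kw; rewrite height_cons; lia.
case: b end0 ge0 step_case => end0 ge0 step_case.
  by apply: step_case => /=; lia.
have := ge0 1 isT; rewrite height_cons height0 /= => h_gt0.
by apply/andP; split; [lia | apply: step_case => /=; lia].
Qed.

(** The two step counts add up to [n.*2], so both equal [n] exactly when the final height is 0. *)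
Lemma dyckE n w : size w = n.*2 -> dyck n w = descends 0 w.
Proof.
move=> size_w; have := height_size w.
have := count_predC (pred1 true) w.
have -> : count (predC (pred1 true)) w = count_mem false w.
  by apply: eq_count => -[].
rewrite size_w => count_sum height_w.
apply/and3P/descendsP => [[/eqP ct /eqP cf /forallP ge0] | [end0 ge0]].
  split; first by rewrite size_w height_w; lia.
  by move=> k le_kw; rewrite add0r; apply: (ge0 (Ordinal (m := k) _)).
move: end0; rewrite size_w height_w => end0.
split; [by apply/eqP; lia | by apply/eqP; lia | apply/forallP => k].
by have := ge0 k; rewrite add0r size_w -ltnS; apply.
Qed.

(** * First visits located by their position *)

(* Here [w] starts at ordinate [h]; the [j] ranging over [0, i] are abscissas of
   points, not only of peaks. *)
Definition first_visit_peak_at (r : nat) (h : int) (w : seq bool) (i : nat) :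
    bool :=
  [&& peak w i, h + height w i.+1 == r%:Z
    & [forall j : 'I_i.+1, h + height w j < r%:Z]].

Lemma first_visit_peak_atP r h w i :
  reflect [/\ peak w i, h + height w i.+1 = r%:Z
             & forall j, (j <= i)%N -> h + height w j < r%:Z]
          (first_visit_peak_at r h w i).
Proof.
apply: (iffP and3P) => -[pk /eqP vis below]; split=> //.
  by move=> j; rewrite -ltnS => lt_ji; apply: (forallP below (Ordinal lt_ji)).
by apply/forallP => j; apply: below; rewrite -ltnS.
Qed.

Lemma first_visit_peak_at_cons r h b w i :
  first_visit_peak_at r h (b :: w) i.+1 =
  (h < r%:Z) && first_visit_peak_at r (h + step b) w i.
Proof.
apply/first_visit_peak_atP/andP => [[pk vis below] | [lt_hr /first_visit_peak_atP]].
  split; first by have := below 0 isT; rewrite height0 addr0.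
  apply/first_visit_peak_atP; split=> [//||j le_ji].
    by rewrite -vis height_cons addrA.
  by have := below j.+1 le_ji; rewrite height_cons addrA.
case=> pk vis below; split=> [//||[|j] le_ji].
- by rewrite height_cons addrA.
- by rewrite height0 addr0.
by rewrite height_cons addrA below.
Qed.

Lemma first_visit_peakE r h w : descends h w -> (h < r)%N ->
  (\sum_(i < size w) first_visit_peak_at r h w i)%N = first_visit_peak r h w.
Proof.
elim: w h => [|b w IHw] h desc lt_hr; first by rewrite big_ord0.
rewrite big_ord_recl.
under eq_bigr => i _ do rewrite first_visit_peak_at_cons ltz_nat lt_hr /=.
have head_at : first_visit_peak_at r h (b :: w) 0 =
    [&& b, h.+1 == r & (0 < size w)%N && ~~ head true w].
  rewrite /first_visit_peak_at height_cons height0 addr0.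
  have -> : [forall j : 'I_1, h%:Z + height (b :: w) j < r%:Z].
    by apply/forallP => j; rewrite (ord1 j) height0 addr0 ltz_nat.
  rewrite /peak andbT; case: b desc => _ /=; last by rewrite andbF.
  have -> : (h%:Z + 1 == r%:Z) = (h.+1 == r) by lia.
  by rewrite andbC; case: (w).
rewrite [X in (nat_of_bool X + _)%N]head_at {head_at}.
case: b desc => /= [desc | /andP[h_gt0 desc]].
  have [eq_hr | neq_hr] := eqVneq h.+1 r.
    rewrite big1 => [|i _]; first by case: (w) => [|[]].
    (* The remaining path starts at [r] itself, so abscissa 0 already breaks the strict bound. *)
    apply/eqP; rewrite eqb0; apply/first_visit_peak_atP => -[_ _ /(_ 0 isT)].
    by rewrite height0; lia.
  rewrite add0n -IHw //; last by lia.
  by apply: eq_bigr => i _; congr (nat_of_bool (first_visit_peak_at _ _ _ _)); lia.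
rewrite add0n -IHw //; last by lia.
by apply: eq_bigr => i _; congr (nat_of_bool (first_visit_peak_at _ _ _ _)); lia.
Qed.

(* If the path reached ordinate [peak_height w i] before its peak at [i], it
   would do so by an up step; from there, either a down step gives an earlier
   peak at least as high, or an up step keeps it there. *)
Lemma strict_lr_maxE w i : descends 0 w ->
  strict_lr_max w i = first_visit_peak_at `|peak_height w i|%N 0 w i.
Proof.
case/descendsP => _ ge0.
have [pk | npk] := boolP (peak w i); last first.
  by rewrite /strict_lr_max /first_visit_peak_at (negPf npk).
have /and3P[lt_iw up_i _] := pk; rewrite /peak_height.
have heightSi : height w i.+1 = height w i + 1.
  by rewrite heightS ?up_i // ltnW.
have Hgt0 : 0 < height w i.+1.
  by have := ge0 i (ltnW (ltnW lt_iw)); rewrite heightSi; lia.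
apply/andP/first_visit_peak_atP => [[_ /forallP prev] | [_ _ below]]; last first.
  split=> //; apply/forallP => j; apply/implyP => _.
  by have := below j.+1 (ltn_ord j); rewrite /peak_height; lia.
split=> //; first by lia.
have no_up d k : (k.+1 + d = i)%N -> nth false w k ->
    height w i.+1 <= height w k.+1 -> False.
  elim: d k => [|d IHd] k kE up_k high_k.
    by move: high_k; rewrite heightSi -kE addn0; lia.
  have lt_ki : (k < i)%N by lia.
  have [up_k1 | down_k1] := boolP (nth false w k.+1).
    apply: (IHd k.+1) => //; first by lia.
    by rewrite (heightS _ k.+1) ?up_k1 /=; lia.
  have := prev (Ordinal lt_ki); rewrite /peak_height /peak /= up_k down_k1.
  by rewrite (_ : (k.+1 < size w)%N) /=; lia.
elim=> [|k IHk] le_ki; first by rewrite height0; lia.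
have := IHk (ltnW le_ki); have lt_kw : (k < size w)%N by lia.
case up_k: (nth false w k); last by rewrite (heightS _ _ lt_kw) up_k /=; lia.
have not_high := no_up _ _ (subnKC le_ki) up_k.
by have [/not_high | ] := lerP (height w i.+1) (height w k.+1); last by lia.
Qed.

(** * Maxima counted height by height *)

(** After exchanging the sums, an index [i] can contribute only for [r] equal to its peak height,
    hence at most once. *)
Lemma card_strict_lr_max N n w : descends 0 w -> (size w < n)%N -> size w = N ->
  #|[set i : 'I_N | strict_lr_max w i]| =
  (\sum_(1 <= r < n) first_visit_peak r 0 w)%N.
Proof.
move=> desc lt_wn <-.
transitivity (\sum_(1 <= r < n) \sum_(i < size w) first_visit_peak_at r 0 w i)%N;
  last by apply: eq_big_nat => r /andP[r_gt0 _]; rewrite first_visit_peakE.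
rewrite exchange_big /= -sum1dep_card big_mkcond /=.
apply: eq_bigr => i _; rewrite strict_lr_maxE //.
set H := `|peak_height w i|%N.
have atH r : first_visit_peak_at r 0 w i -> r = H.
  by case/first_visit_peak_atP => _ vis _; rewrite /H /peak_height; lia.
case: ifPn => [at_i | nat_i]; last first.
  rewrite big1 // => r _; apply/eqP; rewrite eqb0.
  by apply: contra nat_i => at_r; rewrite -(atH r).
(* [H] lies in the range: it exceeds the starting ordinate 0, and a height is at most its abscissa,
   here below [n]. *)
rewrite (bigD1_seq H) ?iota_uniq ?mem_index_iota //=; last first.
  case/first_visit_peak_atP: at_i => _ vis /(_ 0 isT); rewrite height0.
  by have := height_le w i.+1; have := ltn_ord i; rewrite -vis; lia.
rewrite at_i big1 // => r neq_rH; apply/eqP; rewrite eqb0.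
by apply: contra neq_rH => /atH ->.
Qed.

Lemma T_first_visit_peak m n : (m.*2 < n)%N ->
  T m = (\sum_(1 <= r < n)
    count_words m.*2 (fun w => descends 0 w && first_visit_peak r 0 w))%N.
Proof.
move=> lt_mn; rewrite /count_words exchange_big /=.
transitivity (\sum_(w : (m.*2).-tuple bool | dyck m w)
  #|[set i : 'I_(m.*2) | strict_lr_max w i]|)%N => //.
rewrite [LHS]big_mkcond /=.
apply: eq_bigr => w _; rewrite dyckE ?size_tuple //.
case: ifP => [desc | _]; last by rewrite big1.
by rewrite (card_strict_lr_max _ n) ?size_tuple.
Qed.

Lemma descends_even w : descends 0 w -> ~~ odd (size w).
Proof.
case/descendsP; rewrite add0r height_size => end0 _.
have -> : size w = (count_mem true w).*2; last by rewrite odd_double.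
rewrite -(count_predC (pred1 true)).
have -> : count (predC (pred1 true)) w = count_mem false w.
  by apply: eq_count => -[].
by lia.
Qed.

Theorem theorem3 :
  z ^+ 2 = u / (1 + u) ^+ 2 /\
  fps_has_sum 1 (fun r : nat => (1 - u) * u ^+ r / (1 - u ^+ (1 + r))) Tot.
Proof.
split.
  by rewrite [X in X / _]u_fixpoint mulrK // unitrX // one_plus_u_unit.
(* A path of length [k] stays at ordinates at most [k], so the terms with [r > k] do not affect the
   coefficient of [z^k]. *)
move=> k; exists k.+1 => n lt_kn; rewrite fps_coef_sum.
transitivity ((\sum_(1 <= r < n)
    count_words k (fun w => descends 0 w && first_visit_peak r 0 w))%N%:R : rat).
  rewrite natr_sum; apply: eq_big_nat => r /andP[r_gt0 _].
  rewrite first_visit_peak_gf // subn0 expr1 addnn -mul2n exprM.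
  have -> : (z * (1 + u)) ^+ 2 = u by rewrite [RHS]u_fixpoint exprMn.
  by rewrite (mulrC (u ^+ r)).
rewrite /=; case: ifPn => [/andP[_ k_even] | k_out].
  by rewrite (T_first_visit_peak _ n) even_halfK.
(* Here [k] is odd or 0: a descent from 0 to 0 has even length, and the empty path has no peak. *)
rewrite big1 // => r _; apply/eqP; rewrite sum_nat_eq0; apply/forallP => w /=.
rewrite eqb0; apply: contra k_out => /andP[desc vis].
rewrite -[k](size_tuple w) descends_even // andbT lt0n size_eq0.
by apply: contraTneq vis => ->.
Qed.
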